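(* Let $p$ and $q$ be relatively prime positive integers. (i) If $(k,l) \in \{(1,1), (2,1)\}$, then the Ehrhart quasipolynomial of $\mathcal{T}_{\frac{q}{kp},\frac{p}{lq}}$ has period $kl$ if and only if for some integer $n \ge 0$ and some choice of sign, $$(p,q)=(r(k,l)_{2n\pm 1},\,r(k,l)_{2n}) \quad \text{or} \quad (p,q)=(l\,r(k,l)_{2n},\,k\,r(k,l)_{2n\pm1}).$$ (ii) The Ehrhart quasipolynomial of $\mathcal{T}_{\frac{q}{3p},\frac{p}{2q}}$ has period $6$ if, for some integer $n\ge 0$ and some choice of sign, $$(p,q)=(r(3,2)_{2n\pm1},\,r(3,2)_{2n}) \quad \text{or} \quad (p,q)=(2\,r(3,2)_{2n},\,3\,r(3,2)_{2n\pm1}).$$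
   Context: For positive real numbers $u,v$, $\mathcal{T}_{u,v}\subset\mathbb{R}^2$ denotes the (closed, solid) triangle with vertices $(0,0)$, $(0,u)$ and $(v,0)$. For a rational polytope $\mathcal{P}\subset\mathbb{R}^d$, its Ehrhart quasipolynomial is the counting function $L_{\mathcal{P}}(t) = \#(\mathcal{P}\cap \frac{1}{t}\mathbb{Z}^d)$ for positive integers $t$; it is a degree $d$ polynomial in $t$ (for $d$-dimensional $\mathcal{P}$) with coefficients that are periodic functions of $t$. Its period means the minimal period of $L_{\mathcal{P}}$, i.e. the smallest positive integer that is a common period of all its coefficient functions. The sequence $r(k,l)_n$, $n\ge -1$, is defined by $r(k,l)_{-1}=r(k,l)_0=r(k,l)_1=1$ and, for $n\ge 1$, $$r(k,l)_{2n} = \tfrac{k+l+1}{l}\,r(k,l)_{2n-1} - r(k,l)_{2n-2},\qquad r(k,l)_{2n+1} = \tfrac{k+l+1}{k}\, r(k,l)_{2n} - r(k,l)_{2n-1}.$$ *)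

(* Defs.v *)
From mathcomp Require Import all_boot all_order all_algebra.
From mathcomp Require Import finmap.
From mathcomp Require Import all_classical all_reals all_analysis.

Set Implicit Arguments.
Unset Strict Implicit.
Unset Printing Implicit Defensive.

Import Order.TTheory GRing.Theory Num.Theory.
Import numFieldNormedType.Exports.

Local Open Scope classical_set_scope.
Local Open Scope ring_scope.

Definition point2 (R : realType) (x y : R) : 'rV[R]_2 :=
  \row_(i < 2) [:: x; y]`_i.

Definition convex_hull (R : realType) (d : nat) (A : set 'rV[R]_d) :
  set 'rV[R]_d := smallest (@convex_set R 'rV[R]_d) A.

Definition triangle (R : realType) (u v : R) : set 'rV[R]_2 :=
  convex_hull [set point2 0 0; point2 0 u; point2 v 0].

(* The lattice (1/t) Z^d inside R^d. *)
Definition scaled_lattice (R : realType) (d t : nat) : set 'rV[R]_d :=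
  range (fun z : 'rV[int]_d => t%:R^-1 *: map_mx intr z).

(* [fset_set] returns the empty set on infinite sets; the intersection below is
   finite whenever P is bounded and 0 < t. *)
Definition ehrhart (R : realType) (d : nat) (P : set 'rV[R]_d) (t : nat) : nat :=
  #|` fset_set (P `&` @scaled_lattice R d t)|%fset.

(* Only positive arguments t are relevant, both for the counting function and
   for the periodicity of the coefficient functions c i. *)
Definition quasipoly_expansion (R : realType) (d : nat)
    (L : nat -> nat) (c : 'I_d.+1 -> nat -> R) : Prop :=
  forall t : nat, (0 < t)%N -> (L t)%:R = \sum_(i < d.+1) c i t * t%:R ^+ i.

Definition common_period (R : realType) (d : nat)
    (c : 'I_d.+1 -> nat -> R) (N : nat) : Prop :=
  (0 < N)%N /\
  forall (i : 'I_d.+1) (t : nat), (0 < t)%N -> c i (t + N)%N = c i t.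

(* Periodic coefficient functions of an expansion are determined (at positive
   arguments) by the counting function, so N does not depend on c. *)
Definition ehrhart_has_period (R : realType) (d : nat)
    (P : set 'rV[R]_d) (N : nat) : Prop :=
  exists c : 'I_d.+1 -> nat -> R,
    [/\ quasipoly_expansion (ehrhart P) c,
        common_period c N
      & forall M : nat, common_period c M -> (N <= M)%N].

(* r(k,l)_m for m >= 0; the coefficient of the recurrence for the term of
   index m.+2 has denominator l if m is even and k if m is odd. *)
Fixpoint rnat (k l m : nat) {struct m} : rat :=
  match m with
  | 0 | 1 => 1
  | (m'.+1 as m1).+1 =>
      (k + l + 1)%N%:R / (if odd m' then k else l)%:R * rnat k l m1
      - rnat k l m'
  end.

(* r(k,l)_n for n >= -1, with r(k,l)_(-1) = 1; indices n < -1 are not used. *)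
Definition rseq (k l : nat) (n : int) : rat :=
  if n is Posz m then rnat k l m else 1.

(* e ranges over the two signs in the index 2n +- 1. *)
Definition recursive_pair (k l p q : nat) : Prop :=
  exists (n : nat) (e : int), e \in [:: 1; -1] /\
    ((p%:R, q%:R) = (rseq k l (2 * n%:Z + e), rseq k l (2 * n%:Z)) \/
     (p%:R, q%:R) = (l%:R * rseq k l (2 * n%:Z),
                     k%:R * rseq k l (2 * n%:Z + e))).

(* Main.v *)
(* The count is #{x, y >= 0 : l q^2 x + k p^2 y <= t p q}.  If
   k p p' = l q^2 + 1, a piecewise linear shear along the line
   k (p' x + p y) = t q is a lattice bijection from these points onto the ones
   for (p', q); hence along the recursive sequence the count is that of the
   triangle l x + k y <= t, whose period is visibly k l.  It cannot be smaller:
   if M is a common period, the second difference M^2 / (k l) is an integer,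
   and k l is squarefree.
   Conversely, if kl is a period and l q^2, k p^2 are coprime, then evaluating
   L(kl s) at multiples s of pq, where the vertices are integral, determines
   its coefficients, and integrality of L forces
   k p^2 + l q^2 + 1 = c p q with c = k l mod 2; Vieta jumping descends from any
   solution to (1, 1).  The second family in the theorem is the case q = k q',
   p = l p', in which a common factor k l cancels and x, y trade places. *)

Require Import Defs.
From mathcomp Require Import all_boot all_order all_algebra.
From mathcomp Require Import all_classical all_reals all_analysis.
From mathcomp Require Import finmap zify ring lra.

Import Order.TTheory GRing.Theory Num.Theory.
Local Open Scope ring_scope.

(** * Lattice point counts in integer right triangles *)

(** The dilated triangle with denominators cleared; for the triangle of the theorem, a = l q^2, b =
    k p^2 and m = t p q. *)
Definition triangle_points (a b m : nat) : set (int * int) :=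
  [set z | [/\ 0 <= z.1, 0 <= z.2 & a%:Z * z.1 + b%:Z * z.2 <= m%:Z]]%classic.

Definition triangle_count (a b m : nat) : nat :=
  #|` fset_set (triangle_points a b m)|%fset.

Lemma card_fset_set_image (T U : choiceType) (f : T -> U) (A : set T) :
  finite_set A -> {in A &, injective f} ->
  #|` fset_set (f @` A)%classic|%fset = #|` fset_set A|%fset.
Proof.
move=> finA injf; rewrite fset_set_image //.
apply: card_in_imfset => x y xA yA; apply: injf.
  by rewrite -(in_fset_set finA).
by rewrite -(in_fset_set finA).
Qed.

Lemma card_fset_setU (T : choiceType) (A B : set T) :
  finite_set A -> finite_set B -> (A `&` B = set0)%classic ->
  #|` fset_set (A `|` B)%classic|%fset
  = (#|` fset_set A|%fset + #|` fset_set B|%fset)%N.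
Proof.
move=> finA finB AB0.
by rewrite fset_setU // cardfsU -fset_setI // AB0 fset_set0 cardfs0 subn0.
Qed.

Lemma finite_triangle_points (a b m : nat) :
  (0 < a)%N -> (0 < b)%N -> finite_set (triangle_points a b m).
Proof.
move=> a0 b0.
apply: (@sub_finite_set _ _
  ((fun z : nat * nat => (z.1%:Z, z.2%:Z)) @` (`I_m.+1 `*` `I_m.+1)))%classic.
  move=> [x y] [/= x0 y0 h].
  exists (`|x|%N, `|y|%N) => /=; last by rewrite !gez0_abs.
  by split => /=; nia.
by apply: finite_image; apply: finite_setX; exact: finite_II.
Qed.

Lemma triangle_countC (a b m : nat) : (0 < a)%N -> (0 < b)%N ->
  triangle_count a b m = triangle_count b a m.
Proof.
move=> a0 b0; rewrite /triangle_count.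
rewrite -(@card_fset_set_image _ _ (fun z : int * int => (z.2, z.1))
  (triangle_points a b m)); last 2 first.
- exact: finite_triangle_points.
- by move=> [x y] [x' y'] _ _ /= [-> ->].
congr (#|` fset_set _|)%fset; apply/seteqP; split => [[x y]|[x y]] /=.
  by move=> [[x' y']] [/= ? ? ?] [<- <-]; split => //=; rewrite addrC.
by move=> [/= ? ? ?]; exists (y, x) => //; split => //=; rewrite addrC.
Qed.

Lemma triangle_count_scale (d a b m : nat) : (0 < d)%N ->
  triangle_count (d * a) (d * b) (d * m) = triangle_count a b m.
Proof.
move=> d0; congr (#|` fset_set _|)%fset; apply/seteqP.
have E (x y : int) : ((d * a)%:Z * x + (d * b)%:Z * y <= (d * m)%:Z) =
    (a%:Z * x + b%:Z * y <= m%:Z).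
  by rewrite !PoszM -!mulrA -mulrDr ler_pM2l // ltz_nat.
by split => [[x y]|[x y]] [/= x0 y0]; [rewrite E|rewrite -E].
Qed.

Lemma triangle_count_mutation (k l p p' q t : nat) :
  (0 < k)%N -> (0 < l)%N -> (0 < p)%N -> (0 < p')%N -> (0 < q)%N ->
  (k * p * p' = l * q ^ 2 + 1)%N ->
  triangle_count (l * q ^ 2) (k * p ^ 2) (t * (p * q)) =
  triangle_count (k * p' ^ 2) (l * q ^ 2) (t * (p' * q)).
Proof.
move=> k0 l0 p0 p'0 q0 E; rewrite /triangle_count.
(* The shear is along (p, -p'), which is parallel to the line g = 0; in terms
   of g the two slanted constraints read p g <= x and p' g <= y. *)
pose g (z : int * int) : int :=
  k%:Z * (p'%:Z * z.1 + p%:Z * z.2) - t%:Z * q%:Z.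
pose sh (z : int * int) : int * int :=
  if 0 < g z then (z.1 - p%:Z * g z, z.2 + p'%:Z * g z) else z.
have EZ : l%:Z * (q%:Z * q%:Z) = k%:Z * p%:Z * p'%:Z - 1 by lia.
have gsh z : g (sh z) = g z.
  by rewrite /sh; case: ifP => // _; rewrite /g /=; ring.
rewrite -(@card_fset_set_image _ _ sh (triangle_points (l * q ^ 2) _ _));
  last 2 first.
- by apply: finite_triangle_points; rewrite !muln_gt0 ?expn_gt0 ?k0 ?l0 ?p0 ?q0.
- move=> z w _ _ ezw.
  have gzw : g z = g w by rewrite -(gsh z) -(gsh w) ezw.
  move: ezw; rewrite /sh gzw; case: ifP => // _.
  case: z w {gzw} => [x y] [x' y'] /= [e1 e2]; congr pair; lia.
have ineq1 (x y : int) :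
  ((l * q ^ 2)%:Z * x + (k * p ^ 2)%:Z * y <= (t * (p * q))%:Z) =
  (p%:Z * g (x, y) <= x).
  have e : (t * (p * q))%:Z - ((l * q ^ 2)%:Z * x + (k * p ^ 2)%:Z * y) =
      x - p%:Z * g (x, y).
    rewrite -!mulnn !PoszM EZ /g /=; ring.
  by rewrite -subr_ge0 e subr_ge0.
have ineq2 (x y : int) :
  ((k * p' ^ 2)%:Z * x + (l * q ^ 2)%:Z * y <= (t * (p' * q))%:Z) =
  (p'%:Z * g (x, y) <= y).
  have e : (t * (p' * q))%:Z - ((k * p' ^ 2)%:Z * x + (l * q ^ 2)%:Z * y) =
      y - p'%:Z * g (x, y).
    rewrite -!mulnn !PoszM EZ /g /=; ring.
  by rewrite -subr_ge0 e subr_ge0.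
(* Where g <= 0, both slanted constraints follow from x, y >= 0 and nothing moves. Where g > 0, the
   shear turns p g <= x into nonnegativity of the new x, and y >= 0 into the new slanted constraint
   p' g <= y; the two remaining constraints are then automatic. *)
congr (#|` fset_set _|)%fset; apply/seteqP; split => [_ [[x y] + <-]|[x y]].
- rewrite /triangle_points /= ineq1 => -[x0 y0 h].
  have : sh (x, y) = sh (x, y) by [].
  rewrite {2}/sh; case: ifPn => hg E1.
    have g1 : g (sh (x, y)) = g (x, y) := gsh (x, y).
    rewrite E1 /= in g1 *; split; [lia|by rewrite addr_ge0 ?mulr_ge0 // ltW|].
    by rewrite ineq2 g1; lia.
  rewrite E1 /=; split => //; rewrite ineq2.
  by apply: le_trans y0; rewrite pmulr_rle0 ?ltz_nat // leNgt.
- rewrite /triangle_points /= ineq2 => -[x0 y0 h].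
  have [hg|hg] := boolP (0 < g (x, y)); last first.
    exists (x, y); last by rewrite /sh (negbTE hg).
    split => //=; rewrite ineq1.
    by apply: le_trans x0; rewrite pmulr_rle0 ?ltz_nat // leNgt.
  pose x1 := x + p%:Z * g (x, y); pose y1 := y - p'%:Z * g (x, y).
  have g1 : g (x1, y1) = g (x, y) by rewrite /g /x1 /y1 /g /=; ring.
  exists (x1, y1); last by rewrite /sh g1 hg /x1 /y1 /= addrK subrK.
  split => /=; [by rewrite addr_ge0 ?mulr_ge0 // ltW|by rewrite /y1 subr_ge0|].
  by rewrite ineq1 g1 /x1 lerDr.
Qed.

(* Points off the x-axis are shifted down by one. *)
Lemma triangle_count_add (a b m : nat) : (0 < a)%N -> (0 < b)%N ->
  triangle_count a b (m + b) = (triangle_count a b m + ((m + b) %/ a).+1)%N.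
Proof.
move=> a0 b0; rewrite /triangle_count.
pose up (z : int * int) := (z.1, z.2 + 1) : int * int.
pose base (i : nat) := (i%:Z, 0) : int * int.
have -> : triangle_points a b (m + b) =
  (up @` triangle_points a b m `|` base @` `I_((m + b) %/ a).+1)%classic.
  apply/seteqP; split => [[x y]|].
    rewrite /triangle_points /= => -[x0 y0 h].
    have [->|y1] := eqVneq y 0.
      right; exists `|x|%N; last by rewrite /base gez0_abs.
      rewrite /= ltnS leq_divRL // -lez_nat PoszM gez0_abs //; lia.
    left; exists (x, y - 1); last by rewrite /up /= subrK.
    split => /=; [lia|lia|].
    rewrite mulrBr mulr1; lia.
  move=> _ [[[x y] [/= x0 y0 h] <-]|[i /= + <-]].
    rewrite /triangle_points /up; split => /=; [lia|lia|].
    rewrite mulrDr mulr1; lia.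
  rewrite ltnS leq_divRL // => h; rewrite /triangle_points /base; split => //=.
  rewrite mulr0 addr0 -PoszM lez_nat mulnC //.
rewrite card_fset_setU.
- congr addn.
    apply: card_fset_set_image; first exact: finite_triangle_points.
    by move=> [x y] [x' y'] _ _ [-> /addIr ->].
  rewrite card_fset_set_image; [|exact: finite_II|].
    by rewrite fset_set_II card_imfset /= ?size_enum_ord //; exact: val_inj.
  by move=> i j _ _ [].
- by apply: finite_image; exact: finite_triangle_points.
- by apply: finite_image; exact: finite_II.
apply/seteqP; split => // _ [[[x y] [/= _ y0 _] <-] [i _ [_ e]]].
by move: e => /=; lia.
Qed.

Lemma card_fset_set_rectangle (m n : nat) (A : set (int * int)) :
  (forall z, A z <-> [/\ 0 <= z.1 <= m%:Z & 0 <= z.2 <= n%:Z]) ->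
  #|` fset_set A|%fset = (m.+1 * n.+1)%N.
Proof.
move=> hA.
pose f (z : 'I_m.+1 * 'I_n.+1) : int * int := (val z.1 : int, val z.2 : int).
have -> : A = (f @` setT)%classic.
  apply/seteqP; split => [[x y] /hA[/= /andP[x0 x1] /andP[y0 y1]]|].
    have hx : (`|x| < m.+1)%N by lia.
    have hy : (`|y| < n.+1)%N by lia.
    by exists (Ordinal hx, Ordinal hy) => //; rewrite /f /= !gez0_abs.
  move=> _ [[i j] _ <-]; apply/hA => /=.
  by have := ltn_ord i; have := ltn_ord j; lia.
rewrite card_fset_set_image.
- have -> : fset_set [set: 'I_m.+1 * 'I_n.+1]%classic
      = [fset z | z in {: 'I_m.+1 * 'I_n.+1}]%fset.
    apply/fsetP => z; rewrite in_fset_set; last exact: finite_finset.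
    by rewrite in_setT; apply/esym/imfsetP; exists z.
  by rewrite card_imfset //= -cardE card_prod !card_ord.
- exact: finite_finset.
- by move=> [i j] [i' j'] _ _ [/val_inj -> /val_inj ->].
Qed.

(* The triangle and its image under the point reflection of the rectangle cover
   the rectangle and share the r + 1 points of the diagonal. *)
Lemma triangle_count_rectangle (a b r : nat) :
  (0 < a)%N -> (0 < b)%N -> coprime a b ->
  (2 * triangle_count a b (a * b * r) = (a * r).+1 * (b * r).+1 + r.+1)%N.
Proof.
move=> a0 b0 cab; set T := triangle_points a b (a * b * r).
pose opp (z : int * int) := ((b * r)%:Z - z.1, (a * r)%:Z - z.2) : int * int.
have finT : finite_set T by exact: finite_triangle_points.
have finT' : finite_set (opp @` T)%classic by exact: finite_image.
have cT' : #|` fset_set (opp @` T)%classic|%fset = triangle_count a b (a * b * r).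
  rewrite card_fset_set_image // => -[x y] [x' y'] _ _ [e1 e2].
  congr pair; lia.
have bnd (x y : int) : T (x, y) -> x <= (b * r)%:Z /\ y <= (a * r)%:Z.
  move=> [/= x0 y0]; rewrite !PoszM => h; split.
    rewrite -(@ler_pM2l _ a%:Z) ?ltz_nat //; nia.
  rewrite -(@ler_pM2l _ b%:Z) ?ltz_nat //; nia.
have cU : #|` fset_set (T `|` opp @` T)%classic|%fset
    = ((b * r).+1 * (a * r).+1)%N.
  apply: card_fset_set_rectangle => -[x y] /=; split.
    move=> [h|[[x' y'] h [<- <-]]]; have [h1 h2] := bnd _ _ h.
      by case: h => /= h3 h4 _; split; lia.
    by case: h => /= h3 h4 _; split; lia.
  move=> [/andP[x0 x1] /andP[y0 y1]].
  have [h|h] := leP (a%:Z * x + b%:Z * y) (a * b * r)%:Z; first by left; split.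
  right; exists ((b * r)%:Z - x, (a * r)%:Z - y); last first.
    by rewrite /opp /=; congr pair; ring.
  by split => /=; [lia|lia|move: h; rewrite !PoszM; nia].
have cI : #|` fset_set (T `&` opp @` T)%classic|%fset = r.+1.
  (* On the diagonal a x + b y = a b r, coprimality forces b to divide x, so its lattice points are
     the (b i, a (r - i)) with i <= r. *)
  pose d (i : nat) := ((b * i)%N%:Z, (a * (r - i))%N%:Z) : int * int.
  have -> : (T `&` opp @` T = d @` `I_r.+1)%classic.
    apply/seteqP; split => [[x y] [[/= x0 y0 h]]|].
      move=> [[x' y'] [/= x'0 y'0 h'] [e1 e2]].
      have e : a%:Z * x + b%:Z * y = (a * b * r)%:Z.
        by move: h h'; rewrite !PoszM; nia.
      have e' : (a * `|x| + b * `|y| = a * b * r)%N.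
        by apply/eqP; rewrite -eqz_nat PoszD !PoszM !gez0_abs // e !PoszM.
      have : (b %| `|x|)%N.
        rewrite -(@Gauss_dvdr b a) 1?coprime_sym //.
        rewrite -(@dvdn_addl (b * `|y|)) ?dvdn_mulr // e'.
        by rewrite -mulnA mulnCA dvdn_mulr.
      move=> /dvdnP[i ei].
      have ir : (i <= r)%N.
        have [xr _] := bnd x y (And3 x0 y0 h).
        by rewrite -(@leq_pmul2r b) // -ei (mulnC r) -lez_nat gez0_abs.
      have ey : (`|y| = a * (r - i))%N.
        apply/eqP; rewrite -(@eqn_pmul2l b) //; apply/eqP.
        move: e'; rewrite ei -{1}(subnKC ir) => e'.
        have -> : (b * (a * (r - i)) = a * b * (i + (r - i)) - a * (i * b))%N.
          by rewrite mulnDr -!mulnA (mulnC b i) addKn mulnCA.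
        by rewrite -e' addKn.
      exists i; first by rewrite /= ltnS.
      rewrite /d; congr pair; last by rewrite -ey gez0_abs.
      by rewrite mulnC -ei gez0_abs.
    have ed j : (j <= r)%N -> (a * (b * j) + b * (a * (r - j)) = a * b * r)%N.
      by move=> jr; rewrite (mulnCA b) -!mulnDr subnKC // mulnA.
    move=> _ [i /= ir <-]; rewrite ltnS in ir; rewrite /d; split.
      by split => //=; rewrite -!PoszM -PoszD lez_nat ed.
    exists ((b * (r - i))%N%:Z, (a * i)%N%:Z).
      split => //=; rewrite -!PoszM -PoszD lez_nat.
      by rewrite -{2}(subKn ir) ed ?leq_subr.
    have bi : (b * i <= b * r)%N by rewrite leq_mul2l ir orbT.
    have ai : (a * i <= a * r)%N by rewrite leq_mul2l ir orbT.
    by rewrite /opp /= !mulnBr; congr pair; lia.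
  rewrite card_fset_set_image; [|exact: finite_II|].
    by rewrite fset_set_II card_imfset /= ?size_enum_ord //; exact: val_inj.
  by move=> i j _ _ [/eqP]; rewrite eqn_pmul2l // => /eqP.
have := cardfsUI (fset_set T) (fset_set (opp @` T)%classic).
rewrite -fset_setU // -fset_setI // cU cI cT' -/(triangle_count _ _ _).
by rewrite mulnC => ->; rewrite mul2n addnn.
Qed.

(** * The real triangle and its Ehrhart function *)

(** The right-hand side is convex and contains the vertices. Conversely, a point z of it is s w with
    w on the hypotenuse and s = z_0 / v + z_1 / u <= 1, a convex combination of w and the origin. *)
Lemma triangleE (R : realType) (u v : R) : 0 < u -> 0 < v ->
  triangle u v = [set z : 'rV[R]_2 | [/\ 0 <= z 0 0, 0 <= z 0 1
                                   & u * z 0 0 + v * z 0 1 <= u * v]]%classic.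
Proof.
move=> u0 v0; apply/seteqP; split.
  apply: smallest_sub.
    move=> x y lambda /set_mem[x0 x1 x2] /set_mem[y0 y1 y2]; apply/mem_set => /=.
    rewrite /conv /= !mxE.
    have l0 : 0 <= lambda%:num by [].
    have l1 : 0 <= 1 - lambda%:num by rewrite subr_ge0.
    rewrite /unstable.onem; split; [nra|nra|].
    have := ler_wpM2l l0 x2; have := ler_wpM2l l1 y2; nra.
  move=> z [[->|->]|->]; rewrite /= /point2 !mxE /=; split; nra.
move=> z [z0 z1 hz] C [cC hC].
have C0 : C (point2 0 0) by apply: hC; left; left.
have CU : C (point2 0 u) by apply: hC; left; right.
have CV : C (point2 v 0) by apply: hC; right.
have cv (x y : 'rV[R]_2) (s : R) : 0 <= s <= 1 -> C x -> C y ->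
    C (s *: x + (1 - s) *: y).
  move=> /andP[s0 s1] Cx Cy.
  have hs : Itv.spec (@Itv.num_sem R) (Itv.Real `[0%Z, 1%Z]) s.
    by apply/and3P; split => //=; rewrite ?ger0_real.
  have := cC x y (Itv.mk hs).
  by move=> /(_ (mem_set Cx) (mem_set Cy))/set_mem.
pose s := z 0 0 / v + z 0 1 / u.
have s0 : 0 <= s by rewrite addr_ge0 // divr_ge0 // ltW.
have s1 : s <= 1.
  have -> : s = (u * z 0 0 + v * z 0 1) / (u * v).
    by rewrite /s; field; rewrite !gt_eqF.
  by rewrite ler_pdivrMr ?mulr_gt0 // mul1r.
(* Finding w means dividing by s, so the origin is treated apart. *)
have [sz|sN0] := eqVneq s 0.
  have := cv _ _ 0 _ C0 C0; rewrite lexx ler01 => /(_ isT).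
  congr (C _); apply/rowP => i; rewrite !mxE.
  have a0 : 0 <= z 0 0 / v by rewrite divr_ge0 // ltW.
  have b0 : 0 <= z 0 1 / u by rewrite divr_ge0 // ltW.
  move/eqP: sz; rewrite paddr_eq0 // !mulf_eq0 !invr_eq0 (gt_eqF u0) (gt_eqF v0) !orbF.
  move=> /andP[/eqP e0 /eqP e1].
  case: i => [[|[|//]]] hi /=; rewrite !mulr0 addr0.
    by rewrite -e0; congr (z _ _); apply/val_inj.
  by rewrite -e1; congr (z _ _); apply/val_inj.
have sp : 0 < s by rewrite lt_def sN0.
have Cw : C ((z 0 0 / v / s) *: point2 v 0 + (1 - z 0 0 / v / s) *: point2 0 u).
  apply: cv => //; rewrite !divr_ge0 //=; [|exact: ltW].
  by rewrite ler_pdivrMr // mul1r /s lerDl divr_ge0 // ltW.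
have := cv _ _ s _ Cw C0; rewrite s0 s1 => /(_ isT).
congr (C _); apply/rowP => i; rewrite !mxE.
case: i => [[|[|//]]] hi /=; rewrite !mulr0 !addr0 ?add0r.
  rewrite (_ : Ordinal hi = 0); last exact: val_inj.
  by field; rewrite sN0 gt_eqF.
rewrite (_ : Ordinal hi = 1); last exact: val_inj.
have -> : 1 - z 0 0 / v / s = (z 0 1 / u) / s.
  by rewrite -[1](divff sN0) -mulrBl /s addrC addKr.
by field; rewrite sN0 gt_eqF.
Qed.

(** Multiplying the inequality of the hypotenuse at (x / t, y / t) by k l t p q clears all
    denominators. *)
Lemma ehrhart_triangle (R : realType) (k l p q t : nat) :
  (0 < k)%N -> (0 < l)%N -> (0 < p)%N -> (0 < q)%N -> (0 < t)%N ->
  ehrhart (triangle (q%:R / (k%:R * p%:R) : R) (p%:R / (l%:R * q%:R))) t =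
  triangle_count (l * q ^ 2) (k * p ^ 2) (t * (p * q)).
Proof.
move=> k0 l0 p0 q0 t0; rewrite /ehrhart /triangle_count.
have kR : 0 < k%:R :> R by rewrite ltr0n.
have lR : 0 < l%:R :> R by rewrite ltr0n.
have pR : 0 < p%:R :> R by rewrite ltr0n.
have qR : 0 < q%:R :> R by rewrite ltr0n.
have tR : 0 < t%:R :> R by rewrite ltr0n.
rewrite triangleE; [|by rewrite divr_gt0 ?mulr_gt0..].
pose f (z : int * int) : 'rV[R]_2 := point2 (z.1%:~R / t%:R) (z.2%:~R / t%:R).
rewrite -(@card_fset_set_image _ _ f (triangle_points _ _ _)).
- congr (#|` fset_set _|)%fset.
  have key (x y : int) :
    (q%:R / (k%:R * p%:R) * (x%:~R / t%:R) + p%:R / (l%:R * q%:R) * (y%:~R / t%:R)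
      <= q%:R / (k%:R * p%:R) * (p%:R / (l%:R * q%:R)) :> R) =
    ((l * q ^ 2)%:Z * x + (k * p ^ 2)%:Z * y <= (t * (p * q))%:Z).
    rewrite -(ler_int R) -[LHS](@ler_pM2r _ (k%:R * l%:R * t%:R * p%:R * q%:R));
      last by rewrite !mulr_gt0.
    congr (_ <= _).
      rewrite -!mulnn !PoszM !(rmorphD, rmorphM) /= -!pmulrn.
      by field; rewrite !gt_eqF.
    rewrite !PoszM !(rmorphM) /= -!pmulrn.
    by field; rewrite !gt_eqF.
  have nonneg (x : int) : (0 <= x%:~R / t%:R :> R) = (0 <= x).
    by rewrite pmulr_lge0 ?invr_gt0 // ler0z.
  apply/seteqP; split => [w [/= [h0 h1 h2] [z _ ez]]|_ [[x y] [/= h0 h1 h2] <-]].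
    exists (z 0 0, z 0 1).
      move: h0 h1 h2; rewrite -ez !mxE ![_^-1 * _]mulrC key !nonneg.
      by move=> h0 h1 h2; split.
    rewrite -ez; apply/rowP => i; rewrite !mxE [RHS]mulrC.
    by case: i => [[|[|//]]] hi /=; congr (_%:~R / _); congr (z _ _); exact: val_inj.
  split; first by rewrite /= !mxE /= key !nonneg.
  exists (\row_(i < 2) [:: x; y]`_i) => //; apply/rowP => i; rewrite !mxE [LHS]mulrC.
  by case: i => [[|[|//]]] hi.
- by apply: finite_triangle_points; rewrite !muln_gt0 ?expn_gt0 ?k0 ?l0 ?p0 ?q0.
move=> [x y] [x' y'] _ _ /rowP e.
have := e 0; have := e 1; rewrite !mxE /=.
have iV : t%:R^-1 != 0 :> R by rewrite invr_eq0 gt_eqF.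
by move=> /(mulIf iV)/intr_inj -> /(mulIf iV)/intr_inj ->.
Qed.

(** * Quasipolynomial expansions and minimal periods *)

(** For l = 1 this is one use of [triangle_count_add]. For (3, 2) it takes two; exactly one of t + 3
    and t + 6 is odd, so the two floors of halves add up to t + 4. *)
Lemma triangle_count_shift (k l t : nat) :
  (k, l) \in [:: (1, 1); (2, 1); (3, 2)]%N ->
  triangle_count l k (t + k * l) =
  (triangle_count l k t + t + (k * l + k + l + 1)./2)%N.
Proof.
rewrite !inE => /or3P[] /eqP[-> ->]; last first.
  rewrite (_ : (t + 3 * 2 = t + 3 + 3)%N); last by lia.
  by rewrite !triangle_count_add //; lia.
all: by rewrite muln1 triangle_count_add // divn1; lia.
Qed.

(** The coefficients agree at t, t + M and t + 2M, so only the quadratic term survives. *)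
Lemma quasipoly_second_difference (R : realType) (L : nat -> nat)
    (c : 'I_3 -> nat -> R) (M t : nat) :
  quasipoly_expansion L c -> common_period c M -> (0 < t)%N ->
  (L (t + M + M))%:R - 2 * (L (t + M))%:R + (L t)%:R
  = 2 * c (inord 2) t * M%:R ^+ 2.
Proof.
move=> hL [M0 hM] t0.
rewrite !hL ?addn_gt0 ?t0 // !big_ord_recl !big_ord0 /= !hM ?addn_gt0 ?t0 //.
rewrite (_ : lift ord0 (lift ord0 ord0) = inord 2); last first.
  by apply/val_inj; rewrite /= inordK.
rewrite /bump /= !natrD; ring.
Qed.

(** The increment over N is linear in t, so a quadratic polynomial accounts for it up to an
    N-periodic constant term. The divisibility hypothesis expresses that N is squarefree and yields
    minimality. *)
Lemma ehrhart_has_period_shift (R : realType) (P : set 'rV[R]_2) (N s : nat) :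
  (0 < N)%N -> (forall M : nat, (N %| M ^ 2)%N -> (N %| M)%N) ->
  (forall t : nat, (0 < t)%N -> ehrhart P (t + N) = (ehrhart P t + t + s)%N) ->
  ehrhart_has_period P N.
Proof.
move=> N0 sqfree hs.
have NR : N%:R != 0 :> R by rewrite pnatr_eq0 -lt0n.
(* These solve c2 ((t + N)^2 - t^2) + c1 N = t + s for all t; the constant coefficient of [c] takes
   up the rest. *)
pose c2 : R := 1 / (2 * N%:R); pose c1 : R := (2 * s%:R - N%:R) / (2 * N%:R).
pose c (i : 'I_3) (t : nat) : R :=
  [:: (ehrhart P t)%:R - c1 * t%:R - c2 * t%:R ^+ 2; c1; c2]`_i.
have hc : quasipoly_expansion (ehrhart P) c.
  by move=> t t0; rewrite !big_ord_recl big_ord0 /c /= /bump /=; ring.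
exists c; split => //.
  split => // -[[|[|[|//]]]] hi t t0 //; rewrite /c /= hs // !natrD /c1 /c2.
  by field.
move=> M hM; have [M0 _] := hM.
(* The second difference with step M is the integer M^2 / N, so N divides M^2, hence M. *)
have := quasipoly_second_difference _ _ _ _ 1 hc hM isT.
rewrite /c inordK //= /c2 => /(congr1 (fun x => N%:R * x)).
rewrite [RHS](_ : _ = M%:R ^+ 2); last by field.
set x := ehrhart P _; set y := ehrhart P _; set z := ehrhart P _ => e.
apply: dvdn_leq => //; apply: sqfree.
suff : (N * (x + z) = N * (2 * y) + M ^ 2)%N.
  by move=> h; rewrite -(@dvdn_addr (N * (2 * y))) ?dvdn_mulr // -h dvdn_mulr.
apply/eqP; rewrite -(eqr_nat R) natrD natrX -e !natrM natrD; apply/eqP; ring.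
Qed.

(** With period N, f s = L (N s) is one quadratic polynomial for s > 0. As N n^2 = a b, its values
    at s = n r are the half-rectangle counts, which force quadratic coefficient N / 2 and linear
    coefficient (a + b + 1) / (2 n). Then 2 (f 2 - f 1) = (a + b + 1) / n + 3 N is an even
    integer. *)
Lemma ehrhart_period_linear_coef (R : realType) (P : set 'rV[R]_2)
    (a b n N : nat) :
  (0 < a)%N -> (0 < b)%N -> (0 < n)%N -> coprime a b -> (a * b = N * n ^ 2)%N ->
  (forall t, (0 < t)%N -> ehrhart P t = triangle_count a b (t * n)) ->
  ehrhart_has_period P N ->
  exists2 c : nat, (a + b + 1 = c * n)%N & ~~ odd (c + 3 * N).
Proof.
move=> a0 b0 n0 cab eab hP [c [hL [N0 hN] _]].
have perN (i : 'I_3) (s : nat) : c i (N * s.+1)%N = c i N.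
  elim: s => [|s IH]; first by rewrite muln1.
  by rewrite mulnS addnC hN ?IH // muln_gt0 N0.
pose f s := ehrhart P (N * s).
have fE s : (0 < s)%N -> (f s)%:R = c ord0 N + c (inord 1) N * N%:R * s%:R +
    c (inord 2) N * N%:R ^+ 2 * s%:R ^+ 2.
  case: s => // s _; rewrite /f hL ?muln_gt0 ?N0 // !big_ord_recl big_ord0 !perN /=.
  rewrite (_ : lift ord0 (lift ord0 ord0) = inord 2); last first.
    by apply/val_inj; rewrite /= inordK.
  rewrite (_ : lift ord0 ord0 = inord 1); last by apply/val_inj; rewrite /= inordK.
  rewrite /bump /= natrM; ring.
have fr r : (0 < r)%N -> (2 * f (n * r) = (a * r).+1 * (b * r).+1 + r.+1)%N.
  move=> r0; rewrite -triangle_count_rectangle // /f hP ?muln_gt0 ?N0 ?n0 //.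
  by rewrite eab; congr (2 * triangle_count _ _ _)%N; lia.
have frR r : (0 < r)%N ->
    2 * (f (n * r)%N)%:R = (a%:R * r%:R + 1) * (b%:R * r%:R + 1) + r%:R + 1 :> R.
  by move=> r0; rewrite -natrM fr // natrD natrM -!natr1 !natrM; ring.
have h1 := frR 1%N isT; have h2 := frR 2%N isT; have h3 := frR 3%N isT.
rewrite !fE ?muln_gt0 ?n0 // !natrM in h1 h2 h3.
have f1 := fE 1%N isT; have f2 := fE 2%N isT.
have eR : a%:R * b%:R = N%:R * n%:R ^+ 2 :> R by rewrite -natrX -!natrM eab.
have nR : n%:R != 0 :> R by rewrite pnatr_eq0 -lt0n.
move: f1 f2 h1 h2 h3; set X := c (inord 1) N * _; set Y := c (inord 2) N * _.
set Z := c ord0 N => f1 f2 h1 h2 h3.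
have eY : 2 * Y = N%:R.
  have : 2 * Y * n%:R ^+ 2 = N%:R * n%:R ^+ 2 by rewrite -eR; lra.
  by move/mulIf; apply; rewrite expf_neq0.
(* 2 n (f 2 - f 1) with the coefficients of f computed from the values at
   n, 2n, 3n. *)
have key : (a + b + 1 + 3 * N * n + 2 * n * f 1 = 2 * n * f 2)%N.
  apply/eqP; rewrite -(eqr_nat R) !(natrD, natrM) f1 f2; apply/eqP.
  have eYn : 2 * Y * n%:R = N%:R * n%:R by rewrite eY.
  have eYn2 : 2 * Y * n%:R ^+ 2 = N%:R * n%:R ^+ 2 by rewrite eY.
  lra.
(* Ensures that the natural subtractions in the witness for c are not truncated. *)
have lef : (3 * N + 2 * f 1 < 2 * f 2)%N.
  rewrite -(@ltn_pmul2l n) //; lia.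
exists (2 * f 2 - 2 * f 1 - 3 * N)%N; last first.
  rewrite subnK; last by lia.
  by rewrite -mulnBr mul2n odd_double.
rewrite mulnC !mulnBr; lia.
Qed.

(** * Vieta jumping on k p^2 + l q^2 + 1 = c p q *)

(** The witness p' is the second root of k x^2 - c q x + l q^2 + 1: the roots have sum c q / k, an
    integer since k divides c, and product (l q^2 + 1) / k > 0. *)
Lemma vieta_jump (k l c p q : nat) :
  (0 < k)%N -> (0 < p)%N -> (0 < q)%N -> (k %| c)%N ->
  (k * p ^ 2 + l * q ^ 2 + 1 = c * (p * q))%N ->
  exists p' : nat, [/\ (0 < p')%N, (k * (p + p') = c * q)%N,
    (k * p * p' = l * q ^ 2 + 1)%N &
    (k * p' ^ 2 + l * q ^ 2 + 1 = c * (p' * q))%N].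
Proof.
move=> k0 p0 q0 /dvdnP[d ->] e.
have e1 : (p * (d * k * q) = p * (k * p) + (l * q ^ 2 + 1))%N by lia.
have lt : (p < d * q)%N.
  rewrite -(@ltn_pmul2l (p * k)) ?muln_gt0 ?p0 //; lia.
have e2 : (k * p * (d * q - p) = l * q ^ 2 + 1)%N by rewrite mulnBr; lia.
exists (d * q - p)%N; split => //; first by rewrite subn_gt0.
  by rewrite (subnKC (ltnW lt)); lia.
rewrite -addnA -e2; set p' := (d * q - p)%N.
have e3 : (p + p' = d * q)%N by rewrite (subnKC (ltnW lt)).
have -> : (d * k * (p' * q) = k * p' * (d * q))%N by lia.
by rewrite -e3; lia.
Qed.

(** Induction on p + q, jumping in whichever coordinate decreases. If neither does, p <= p' gives k
    p^2 <= k p p' = l q^2 + 1, and likewise for q: these are the two inequalities of the base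
    case. *)
Lemma vieta_descent (k l c : nat) (P : nat -> nat -> Prop) :
  (0 < k)%N -> (0 < l)%N -> (k %| c)%N -> (l %| c)%N ->
  (forall p q, (0 < p)%N -> (0 < q)%N ->
     (k * p ^ 2 + l * q ^ 2 + 1 = c * (p * q))%N ->
     (k * p ^ 2 <= l * q ^ 2 + 1)%N -> (l * q ^ 2 <= k * p ^ 2 + 1)%N -> P p q) ->
  (forall p p' q, (0 < p)%N -> (k * (p + p') = c * q)%N -> P p' q -> P p q) ->
  (forall p q q', (0 < q)%N -> (l * (q + q') = c * p)%N -> P p q' -> P p q) ->
  forall p q, (0 < p)%N -> (0 < q)%N ->
    (k * p ^ 2 + l * q ^ 2 + 1 = c * (p * q))%N -> P p q.
Proof.
move=> k0 l0 kc lc hmin hp hq p q.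
have [m] := ubnP (p + q)%N; elim: m p q => // m IH p q lem p0 q0 e.
have [p' [p'0 s1 t1 e1]] := vieta_jump _ l _ _ _ k0 p0 q0 kc e.
have [lp|lp] := ltnP p' p.
  by apply: (hp _ p') => //; apply: IH => //; lia.
have e' : (l * q ^ 2 + k * p ^ 2 + 1 = c * (q * p))%N by lia.
have [q' [q'0 s2 t2 e2]] := vieta_jump _ k _ _ _ l0 q0 p0 lc e'.
have [lq|lq] := ltnP q' q.
  by apply: (hq _ _ q') => //; apply: IH => //; lia.
apply: hmin => //.
  by rewrite -t1 -mulnA leq_mul2l -mulnn leq_mul2l lp !orbT.
by rewrite -t2 -mulnA leq_mul2l -mulnn leq_mul2l lq !orbT.
Qed.

Lemma rnatSS (k l m : nat) :
  rnat k l m.+2 = (k + l + 1)%N%:R / (if odd m then k else l)%:R * rnat k l m.+1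
                  - rnat k l m.
Proof. by []. Qed.

Lemma vieta_solutions11 (c p q : nat) : (0 < p)%N -> (0 < q)%N ->
  (1 * p ^ 2 + 1 * q ^ 2 + 1 = c * (p * q))%N ->
  c = 3%N /\ exists m,
    (p%:R = rnat 1 1 m /\ q%:R = rnat 1 1 m.+1) \/
    (p%:R = rnat 1 1 m.+1 /\ q%:R = rnat 1 1 m).
Proof.
pose Q p q := exists m,
    (p%:R = rnat 1 1 m /\ q%:R = rnat 1 1 m.+1) \/
    (p%:R = rnat 1 1 m.+1 /\ q%:R = rnat 1 1 m).
rewrite -[exists m, _]/(Q p q).
have Qsym x y : Q x y -> Q y x.
  by move=> [m [[h1 h2]|[h1 h2]]]; exists m; [right|left].
have step x x' y : (x + x' = 3 * y)%N -> Q x' y -> Q x y.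
  move=> e; have {}e : x%:R = 3 * y%:R - x'%:R :> rat.
    by rewrite -natrM -e natrD addrK.
  have rec n : rnat 1 1 n.+2 = 3 * rnat 1 1 n.+1 - rnat 1 1 n.
    by rewrite rnatSS if_same divr1.
  move=> [m [[h1 h2]|[h1 h2]]].
    by exists m.+1; right; rewrite e h1 h2 rec.
  (* The sequence is symmetric about r(0) = r(1) = 1: stepping back from there gives 3 - 1 = 2 =
     r(2), paired with r(1). *)
  case: m h1 h2 => [|m] h1 h2.
    by exists 1%N; right; split; rewrite ?e ?h1 h2.
  by exists m; left; rewrite e h1 h2 rec; split => //; ring.
move: p q; apply: vieta_descent => //; try by rewrite dvd1n.
- move=> p q p0 q0 e h1 h2.
  (* The squares of p and q differ by at most 1. With p = q the equation makes p divide 1, so the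
     descent ends at (1, 1) with c = 3. *)
  have epq : p = q by nia.
  rewrite -epq !mul1n in e *.
  have p1 : p = 1%N.
    apply/eqP; rewrite -dvdn1 -(@dvdn_addr (p ^ 2 + p ^ 2)).
      by rewrite e mulnA dvdn_mull.
    by rewrite dvdn_add // dvdn_exp.
  rewrite p1 in e *; split; [lia|by exists 0%N; left].
- by move=> p p' q _ e [c3 h]; split => //; apply: step h; rewrite -c3; lia.
by move=> p q q' _ e [c3 /Qsym h]; split => //; apply: Qsym; apply: step h; rewrite -c3; lia.
Qed.

(** Descent ends at (1, 1) with c = 4. Evenness of c matters: (p, q) = (2, 1) solves the equation
    with c = 5. *)
Lemma vieta_solutions21 (c p q : nat) : (0 < p)%N -> (0 < q)%N -> ~~ odd c ->
  (2 * p ^ 2 + 1 * q ^ 2 + 1 = c * (p * q))%N ->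
  c = 4%N /\ exists n, p%:R = rnat 2 1 n.*2.+1 /\
    (q%:R = rnat 2 1 n.*2 \/ q%:R = rnat 2 1 n.*2.+2).
Proof.
move=> + + ec; have c2 : (2 %| c)%N by rewrite dvdn2.
pose Q p q := exists n, p%:R = rnat 2 1 n.*2.+1 /\
    (q%:R = rnat 2 1 n.*2 \/ q%:R = rnat 2 1 n.*2.+2).
rewrite -[exists m, _]/(Q p q).
have rec0 n : rnat 2 1 n.*2.+2 = 4 * rnat 2 1 n.*2.+1 - rnat 2 1 n.*2.
  by rewrite rnatSS odd_double divr1.
have rec1 n : rnat 2 1 n.*2.+3 = 2 * rnat 2 1 n.*2.+2 - rnat 2 1 n.*2.+1.
  by rewrite rnatSS /= odd_double.
move: p q; apply: vieta_descent => //; try by rewrite dvd1n.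
- move=> p q p0 q0 e h1 h2; rewrite mul1n in e h1 h2.
  have [d ed] : exists d, c = (d * 2)%N by apply/dvdnP.
  have oq : odd q.
    have := congr1 odd e; rewrite ed !(oddD, oddM, oddX) /= andbF /=.
    by case: (odd q).
  (* In the first case the equation makes q divide q^2 + 1, so p = q = 1. In the second p divides 1,
     whence q^2 = 3, which is impossible. The third contradicts q odd. *)
  have [h|[h|h]] : (2 * p ^ 2 = q ^ 2 + 1 \/ q ^ 2 = 2 * p ^ 2 + 1 \/
      2 * p ^ 2 = q ^ 2)%N by lia.
  + have e1 : (2 * p = d * q)%N.
      by apply/eqP; rewrite -(@eqn_pmul2l (2 * p)) ?muln_gt0 ?p0 //; lia.
    have q1 : q = 1%N.
      apply/eqP; rewrite -dvdn1 -(@dvdn_addr (q ^ 2)) ?dvdn_exp // -h.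
      by rewrite -mulnn mulnA e1 -mulnA mulnCA dvdn_mulr.
    have p1 : p = 1%N by rewrite q1 in h; nia.
    rewrite p1 q1 in e1 *; split; [lia|by exists 0%N; split=> //; left].
  + have e1 : (q = d * p)%N.
      by apply/eqP; rewrite -(@eqn_pmul2l (2 * q)) ?muln_gt0 ?q0 //; lia.
    have p1 : p = 1%N.
      apply/eqP; rewrite -dvdn1 -(@dvdn_addr (2 * p ^ 2)).
        by rewrite -h e1 -mulnn dvdn_mull ?dvdn_mull.
      by rewrite dvdn_mull ?dvdn_exp.
    by rewrite p1 muln1 in h e1; rewrite e1 in h; nia.
  + by have := congr1 odd h; rewrite oddM !oddX /= oq.
- move=> p p' q _ e [c4 [n [h1 h2]]]; split => //.
  have {}e : p%:R = 2 * q%:R - p'%:R :> rat.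
    by rewrite -natrM (_ : 2 * q = p + p')%N ?natrD ?addrK //; lia.
  case: h2 => h2; last first.
    exists n.+1; rewrite doubleS; split; last by left.
    by rewrite rec1 e h1 h2.
  (* For n = 0 the jump gives 2 - 1 = 1, that is r(-1), which equals r(1). *)
  case: n h1 h2 => [|n] h1 h2.
    by exists 0%N; rewrite e h1 h2; split => //; left.
  rewrite doubleS in h1 h2; exists n; split; last by right.
  by rewrite e h1 h2 rec1; ring.
- move=> p q q' _ e [c4 [n [h1 h2]]]; split => //.
  have {}e : q%:R = 4 * p%:R - q'%:R :> rat.
    by rewrite -natrM (_ : 4 * p = q + q')%N ?natrD ?addrK //; lia.
  exists n; split => //; case: h2 => h2; [right|left].
    by rewrite rec0 e h1 h2.
  by rewrite e h1 h2 rec0; ring.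
Qed.

(** * The count along the recursive sequence *)

(** Here x is the term of odd index and y that of even index. Each step of the recurrence is a Vieta
    jump, so integrality, positivity and the equation persist; the product of the two roots is the
    hypothesis of [triangle_count_mutation], so the count persists too. *)
Lemma rnat_chain (k l m : nat) :
  (0 < k)%N -> (0 < l)%N -> (k %| k + l + 1)%N -> (l %| k + l + 1)%N ->
  exists a b : nat, [/\ (0 < a)%N, (0 < b)%N, rnat k l m = a%:R,
    rnat k l m.+1 = b%:R &
    let x := if odd m then a else b in let y := if odd m then b else a in
    (k * x ^ 2 + l * y ^ 2 + 1 = (k + l + 1) * (x * y))%N /\
    forall t, triangle_count (l * y ^ 2) (k * x ^ 2) (t * (x * y)) =
              triangle_count l k t].
Proof.
move=> k0 l0 kc lc; elim: m => [|m [a [b [a0 b0 ra rb]]]].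
  exists 1%N, 1%N; split => //=; rewrite !muln1; split => // t; by rewrite muln1.
(* The sum of the two roots is the recurrence, with d = k or l according to parity. *)
have next (d c' : nat) : (0 < d)%N -> (d * (a + c') = (k + l + 1) * b)%N ->
    c'%:R = (k + l + 1)%N%:R / d%:R * b%:R - a%:R :> rat.
  move=> d0 /(congr1 (fun n => n%:R : rat)); rewrite !(natrD, natrM) => e.
  have dR : d%:R != 0 :> rat by rewrite pnatr_eq0 -lt0n.
  apply: (mulfI dR); rewrite mulrBr mulrA mulrCA divff // mulr1; lra.
move: (rnat k l m.+2) (rnatSS k l m).
move: (rnat k l m.+1) rb => z1 rb z; rewrite ra rb => ez.
case om: (odd m) ez => /= ez [e ct].
- have [a' [a'0 s1 t1 e1]] := vieta_jump _ _ _ _ _ k0 a0 b0 kc e.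
  exists b, a'; split => //; first by rewrite ez (next k a').
  rewrite om /=.
  split => // t; rewrite -ct (triangle_count_mutation _ _ a a') //.
  by rewrite triangle_countC ?muln_gt0 ?expn_gt0 ?k0 ?l0 ?a'0 ?b0.
(* For even m the jump is in the coordinate of weight l, so k and l trade places and the triangles
   are reflected before and after the mutation. *)
- have {}e : (l * a ^ 2 + k * b ^ 2 + 1 = (k + l + 1) * (a * b))%N by lia.
  have [a' [a'0 s1 t1 e1]] := vieta_jump _ _ _ _ _ l0 a0 b0 lc e.
  exists b, a'; split => //; first by rewrite ez (next l a').
  rewrite om /=.
  split => [|t]; first lia.
  rewrite -ct triangle_countC ?muln_gt0 ?expn_gt0 ?k0 ?l0 ?a'0 ?b0 //.
  rewrite [RHS]triangle_countC ?muln_gt0 ?expn_gt0 ?k0 ?l0 ?a0 ?b0 //.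
  rewrite (mulnC b a) (triangle_count_mutation _ _ a a') // (mulnC b a').
  by rewrite triangle_countC ?muln_gt0 ?expn_gt0 ?k0 ?l0 ?a'0 ?b0.
Qed.

(* The index -1, with r(-1) = r(1), is subsumed by n = 0, m = 1. *)
Lemma recursive_pairP (k l p q : nat) : recursive_pair k l p q <->
  exists n m, (m = n.*2.+1 \/ n.*2 = m.+1) /\
    ((p%:R = rnat k l m /\ q%:R = rnat k l n.*2) \/
     (p%:R = l%:R * rnat k l n.*2 /\ q%:R = k%:R * rnat k l m)).
Proof.
have e0 (n : nat) : rseq k l (2 * n%:Z) = rnat k l n.*2.
  by rewrite (_ : 2 * n%:Z = n.*2%:Z) //; lia.
have e1 (n : nat) : rseq k l (2 * n%:Z + 1) = rnat k l n.*2.+1.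
  by rewrite (_ : 2 * n%:Z + 1 = n.*2.+1%:Z) //; lia.
have e2 (n : nat) : rseq k l (2 * n.+1%:Z - 1) = rnat k l n.*2.+1.
  by rewrite (_ : 2 * n.+1%:Z - 1 = n.*2.+1%:Z) //; lia.
split.
  move=> [n [e [+ h]]]; rewrite !inE => /orP[] /eqP ee; subst e.
    exists n, n.*2.+1; split; first by left.
    by move: h; rewrite e0 e1 => -[[-> ->]|[-> ->]]; [left|right].
  case: n h => [|n] h.
    by exists 0%N, 1%N; split; [left|case: h => -[-> ->]; [left|right]].
  exists n.+1, n.*2.+1; split; first by right.
  by move: h; rewrite e0 e2 => -[[-> ->]|[-> ->]]; [left|right].
move=> [n [m [hm h]]].
case: hm => hm.
  exists n, 1; split => //; rewrite e0 e1 -hm.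
  by case: h => -[-> ->]; [left|right].
case: n hm h => // n; rewrite doubleS => -[<-] h.
exists n.+1, (-1); split => //; rewrite e0 e2 doubleS.
by case: h => -[-> ->]; [left|right].
Qed.

Lemma recursive_pair_count (k l p q t : nat) :
  (0 < k)%N -> (0 < l)%N -> (k %| k + l + 1)%N -> (l %| k + l + 1)%N ->
  recursive_pair k l p q ->
  triangle_count (l * q ^ 2) (k * p ^ 2) (t * (p * q)) = triangle_count l k t.
Proof.
move=> k0 l0 kc lc /recursive_pairP[n [m [hm h]]].
have [x [y [x0 y0 ex ey hxy]]] : exists x y : nat, [/\ (0 < x)%N, (0 < y)%N,
    rnat k l m = x%:R, rnat k l n.*2 = y%:R &
    triangle_count (l * y ^ 2) (k * x ^ 2) (t * (x * y)) = triangle_count l k t].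
  case: hm => hm.
    have [a [b [a0 b0 ra rb]]] := rnat_chain k l n.*2 k0 l0 kc lc.
    by rewrite odd_double /= => -[_ ct]; exists b, a; rewrite hm.
  have [a [b [a0 b0 ra rb]]] := rnat_chain k l m k0 l0 kc lc.
  have -> : odd m by have := odd_double n; rewrite hm /= => /negbFE.
  by move=> -[_ ct]; exists a, b; rewrite hm.
rewrite -hxy; case: h => -[]; rewrite ex ey -?natrM => /eqP + /eqP;
  rewrite !eqr_nat => /eqP-> /eqP-> //.
(* Only the second family, p = l y and q = k x, remains: both weights and the bound contain the
   factor k l. *)
rewrite -(@triangle_count_scale (k * l) (l * y ^ 2)) ?muln_gt0 ?k0 //.
rewrite triangle_countC ?muln_gt0 ?expn_gt0 ?k0 ?l0 ?x0 ?y0 //.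
by congr triangle_count; lia.
Qed.

Lemma recursive_pair_period (R : realType) (k l p q : nat) :
  (k, l) \in [:: (1, 1); (2, 1); (3, 2)]%N -> (0 < p)%N -> (0 < q)%N ->
  recursive_pair k l p q ->
  ehrhart_has_period
    (triangle (q%:R / (k%:R * p%:R) : R) (p%:R / (l%:R * q%:R))) (k * l).
Proof.
move=> hkl p0 q0 hr.
have [k0 l0 kc lc] : [/\ (0 < k)%N, (0 < l)%N,
    (k %| k + l + 1)%N & (l %| k + l + 1)%N].
  by move: hkl; rewrite !inE => /or3P[] /eqP[-> ->].
apply: (@ehrhart_has_period_shift _ _ _ (k * l + k + l + 1)./2).
- by rewrite muln_gt0 k0.
- move=> M; move: hkl; rewrite !inE => /or3P[] /eqP[-> ->]; rewrite ?dvd1n //.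
    by rewrite -mulnn Euclid_dvdM // orbb.
  by rewrite !Gauss_dvd // -mulnn !Euclid_dvdM // !orbb.
move=> t t0; rewrite !ehrhart_triangle ?addn_gt0 ?t0 //.
by rewrite !recursive_pair_count // triangle_count_shift.
Qed.

(** * From the period back to the recursive sequence *)

Lemma period_recursive_pair11 (R : realType) (p q : nat) :
  (0 < p)%N -> (0 < q)%N -> coprime p q ->
  ehrhart_has_period
    (triangle (q%:R / (1%:R * p%:R) : R) (p%:R / (1%:R * q%:R))) 1 ->
  recursive_pair 1 1 p q.
Proof.
move=> p0 q0 cpq.
move=> /(@ehrhart_period_linear_coef _ _ (1 * q ^ 2) (1 * p ^ 2) (p * q)) [].
- by rewrite mul1n expn_gt0 q0.
- by rewrite mul1n expn_gt0 p0.
- by rewrite muln_gt0 p0.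
- by rewrite !mul1n coprimeXl // coprimeXr // coprime_sym.
- by rewrite !mul1n expnMn mulnC.
- by move=> t t0; rewrite ehrhart_triangle.
rewrite (addnC (1 * q ^ 2)%N) => c /(vieta_solutions11 _ _ _ p0 q0)[_ [m hm]] _.
(* For k = l = 1 the two families differ only in which of p, q has even index, so the parity of m
   selects the family. *)
apply/recursive_pairP; rewrite -(odd_double_half m) in hm.
case: (odd m) hm => /=; rewrite ?add1n ?add0n; set n := m./2 => hm.
  exists n.+1, n.*2.+1; split; first by right.
  by rewrite doubleS !mul1r; case: hm => -[-> ->]; [left|right].
exists n, n.*2.+1; split; first by left.
by rewrite !mul1r; case: hm => -[-> ->]; [right|left].
Qed.

(** The weights q^2 and 2 p^2 are coprime only for odd q, which leads to the first family. For q = 2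
    a a factor 2 cancels, leaving the coprime weights 2 a^2 and p^2; then (a, p) solves the same
    equation, which gives the second family. *)
Lemma period_recursive_pair21 (R : realType) (p q : nat) :
  (0 < p)%N -> (0 < q)%N -> coprime p q ->
  ehrhart_has_period
    (triangle (q%:R / (2%:R * p%:R) : R) (p%:R / (1%:R * q%:R))) 2 ->
  recursive_pair 2 1 p q.
Proof.
move=> p0 q0 cpq hper; apply/recursive_pairP.
have [oq|eq] := boolP (odd q).
- move: hper.
  move=> /(@ehrhart_period_linear_coef _ _ (1 * q ^ 2) (2 * p ^ 2) (p * q)) [].
  + by rewrite mul1n expn_gt0 q0.
  + by rewrite muln_gt0 expn_gt0 p0.
  + by rewrite muln_gt0 p0.
  + rewrite mul1n coprimeMr !coprimeXl ?coprimen2 //= coprimeXr //.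
    by rewrite coprime_sym.
  + by rewrite mul1n expnMn; lia.
  + by move=> t t0; rewrite ehrhart_triangle.
  move=> c; rewrite (addnC (1 * q ^ 2)%N) => e oc.
  (* With N = 2 the parity condition on c + 3 N says that c is even. *)
  have {}oc : ~~ odd c by move: oc; rewrite oddD /= addbF.
  have [_ [n [-> [->|->]]]] := vieta_solutions21 _ _ _ p0 q0 oc e.
    by exists n, n.*2.+1; split; left.
  by exists n.+1, n.*2.+1; rewrite doubleS; split; [right|left].
have [a ea] : exists a, q = (2 * a)%N.
  by exists q./2; rewrite mul2n even_halfK.
have a0 : (0 < a)%N by lia.
have op : odd p by rewrite -coprimen2; move: cpq; rewrite ea coprimeMr => /andP[].
have cpa : coprime a p.
  by rewrite coprime_sym; move: cpq; rewrite ea coprimeMr => /andP[].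
move: hper.
move=> /(@ehrhart_period_linear_coef _ _ (2 * a ^ 2) (1 * p ^ 2) (a * p)) [].
- by rewrite muln_gt0 expn_gt0 a0.
- by rewrite mul1n expn_gt0 p0.
- by rewrite muln_gt0 a0.
- by rewrite mul1n coprimeMl !coprimeXr ?coprime2n //= coprimeXl.
- by rewrite mul1n expnMn; lia.
- move=> t t0; rewrite ehrhart_triangle // ea.
  rewrite -[RHS](@triangle_count_scale 2) //; congr triangle_count; lia.
move=> c e oc.
have {}oc : ~~ odd c by move: oc; rewrite oddD /= addbF.
have [_ [n [h1 h2]]] := vieta_solutions21 _ _ _ a0 p0 oc e.
rewrite ea natrM h1; case: h2 => ->.
  by exists n, n.*2.+1; rewrite mul1r; split; [left|right].
by exists n.+1, n.*2.+1; rewrite doubleS mul1r; split; right.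
Qed.

Theorem theorem1p6 (R : realType) (p q : nat)
    (hp : (0 < p)%N) (hq : (0 < q)%N) (hpq : coprime p q) :
  (forall k l : nat, (k, l) \in [:: (1, 1); (2, 1)]%N ->
     (ehrhart_has_period
        (triangle (q%:R / (k%:R * p%:R) : R) (p%:R / (l%:R * q%:R))) (k * l)
      <-> recursive_pair k l p q)) /\
  (recursive_pair 3 2 p q ->
     ehrhart_has_period
       (triangle (q%:R / (3 * p%:R) : R) (p%:R / (2 * q%:R))) 6).
Proof.
split; last exact: recursive_pair_period.
move=> k l hkl; split; last first.
  apply: recursive_pair_period => //.
  by move: hkl; rewrite !inE => /orP[] ->; rewrite ?orbT.
move: hkl; rewrite !inE => /orP[] /eqP[-> ->].
  exact: period_recursive_pair11.
exact: period_recursive_pair21.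
Qed.
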